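(* Suppose the disutilities of drivers follow the additive random utility assumption given in the context. Then the optimal value function $z^\star_{od}(\mathbf{f})$ of the sub-problem is approximated by $$z^\star_{od}(\mathbf{f})\approx\sum_{rs\in\mathcal{T}}f^{rs}_{od}(\overline{c}_{rs}-C^{rs}_{od})-\hat{H}_{od}(\mathbf{f}),\qquad \hat{H}_{od}(\mathbf{f})=q_{od}\,H_{od}(\mathbf{f}_{od}/q_{od}),$$ where $H_{od}(\mathbf{p})=\max_{\mathbf{v}\in\mathbb{R}^{\mathcal{T}}}\{\mathbf{p}\cdot\mathbf{v}-S_{od}(\mathbf{v})\}$ is the convex conjugate of the expected maximum utility $S_{od}$ (so that $-H_{od}$ is the generalized entropy function, for any additive random utility discrete choice model). That is, the fluid approximation $\tilde z_{od}(\mathbf{f})$ of $z^\star_{od}(\mathbf{f})$ defined in the context satisfies exactly $$\tilde z_{od}(\mathbf{f})=\sum_{rs\in\mathcal{T}}f^{rs}_{od}(\overline{c}_{rs}-C^{rs}_{od})-\hat{H}_{od}(\mathbf{f}).$$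
   Context: $\mathcal{A}_{od}$ is a finite nonempty set of drivers with OD pair $(o,d)$, $q_{od}=|\mathcal{A}_{od}|$, $\mathcal{T}$ a finite nonempty set of pickup-delivery pairs $rs$; $\overline{c}_{rs}\in\mathbb{R}$ is the dedicated-vehicle cost, $c^{rs}_a$ the disutility of driver $a$ for a task for $rs$. $\mathbf{f}_{od}=(f^{rs}_{od})_{rs\in\mathcal{T}}\ge 0$ is the vector of numbers of tasks allocated to the group, with $\sum_{rs}f^{rs}_{od}=q_{od}$. $z^\star_{od}(\mathbf{f})$ is the optimal value of maximizing $\sum_{a\in\mathcal{A}_{od}}\sum_{rs\in\mathcal{T}}(\overline{c}_{rs}-c^{rs}_a)y^{rs}_a$ subject to $\sum_{rs}y^{rs}_a=1$ for all $a\in\mathcal{A}_{od}$, $\sum_{a\in\mathcal{A}_{od}}y^{rs}_a=f^{rs}_{od}$ for all $rs$, $y^{rs}_a\in\{0,1\}$. By Lagrangian duality, $z^\star_{od}(\mathbf{f})=\min_{\boldsymbol{\sigma}}\big\{\sum_{a\in\mathcal{A}_{od}}\max_{rs\in\mathcal{T}}\{\overline{c}_{rs}-c^{rs}_a-\sigma^{rs}_{od}\}+\sum_{rs}f^{rs}_{od}\sigma^{rs}_{od}\big\}$ over $\boldsymbol{\sigma}\in\mathbb{R}^{\mathcal{T}}$. Additive random utility assumption: there is a sufficiently large number of drivers for each OD pair, and $c^{rs}_a\approx C^{rs}_{od}-\epsilon^{rs}_a$ for $a\in\mathcal{A}_{od}$, where $C^{rs}_{od}\in\mathbb{R}$ is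 deterministic and the random vector $(\epsilon^{rs}_a)_{rs\in\mathcal{T}}$ follows a continuous joint distribution with finite means, independent of $C^{rs}_{od}$ (the same distribution for all drivers in $\mathcal{A}_{od}$). The expected maximum utility is $S_{od}(\mathbf{v})=\mathbb{E}\big[\max_{rs\in\mathcal{T}}\{v^{rs}+\epsilon^{rs}_a\}\big]$, $\mathbf{v}\in\mathbb{R}^{\mathcal{T}}$. Meaning of $\approx$: under this assumption the sum $\sum_{a\in\mathcal{A}_{od}}\max_{rs}\{\overline{c}_{rs}-c^{rs}_a-\sigma^{rs}_{od}\}$ in the dual is replaced by $q_{od}S_{od}(\mathbf{v}_{od})$ with $v^{rs}_{od}=\overline{c}_{rs}-\sigma^{rs}_{od}-C^{rs}_{od}$, giving the fluid approximation $$\tilde z_{od}(\mathbf{f})=\min_{\boldsymbol{\sigma}\in\mathbb{R}^{\mathcal{T}}}\Big\{q_{od}\,S_{od}\big((\overline{c}_{rs}-\sigma^{rs}_{od}-C^{rs}_{od})_{rs\in\mathcal{T}}\big)+\sum_{rs\in\mathcal{T}}f^{rs}_{od}\sigma^{rs}_{od}\Big\}.$$ Here min and max over $\boldsymbol{\sigma}$ and $\mathbf{v}$ are understood as infimum and supremum when not attained. *)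

(* Defs.v *)
From HB Require Import structures.
From mathcomp Require Import all_boot all_order all_algebra.
From mathcomp Require Import all_classical all_reals all_analysis.
Import Order.TTheory GRing.Theory Num.Theory.
Import numFieldNormedType.Exports.

Set Implicit Arguments.
Unset Strict Implicit.
Unset Printing Implicit Defensive.

Local Open Scope classical_set_scope.
Local Open Scope ring_scope.

Section RandomVectors.
Context d (Omega : measurableType d) (R : realType) (P : probability Omega R).
Variable T : finType.

Definition joint_cdf (X : T -> {RV P >-> R}) (x : T -> R) : \bar R :=
  P [set w | forall rs, X rs w <= x rs].

(* The generators of the product sigma-algebra on R^T. *)
Definition coordinate_cylinders : set (set (T -> R)) :=
  [set Z | exists rs, exists2 B : set R, measurable B & Z = [set x | B (x rs)]].

Definition same_joint_law (X Y : T -> {RV P >-> R}) : Prop :=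
  forall Z : set (T -> R), <<s coordinate_cylinders >> Z ->
    P [set w | Z (fun rs => X rs w)] = P [set w | Z (fun rs => Y rs w)].

(* "Continuous joint distribution" means that the joint distribution function
   is continuous on R^T; existence of a joint density is not required.
   Distinct drivers may be dependent: only their laws are constrained. *)
Record additive_random_utility (A : finType) (C : T -> R)
    (c : A -> T -> Omega -> R) (eps : A -> T -> {RV P >-> R}) : Prop := {
  aru_disutility : forall a rs w, c a rs w = C rs - eps a rs w;
  aru_continuous : forall a,
    continuous (joint_cdf (eps a) : {ptws T -> R} -> \bar R);
  aru_finite_mean : forall a rs, P.-integrable setT (EFin \o eps a rs);
  aru_same_law : forall a b, same_joint_law (eps a) (eps b)
}.

(* The supremum below is over a finite set, hence a maximum when T is
   nonempty. *)
Definition expected_max_utility (e : T -> {RV P >-> R}) (v : T -> R) : \bar R :=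
  'E_P[fun w => sup (range (fun rs => v rs + e rs w))].

End RandomVectors.

(* Extrema over R^T are taken in the extended reals, so that they exist whether
   or not they are attained. *)
Section FluidApproximation.
Context (R : realType) (T : finType).
Local Open Scope ereal_scope.

Definition convex_conjugate (S : (T -> R) -> \bar R) (p : T -> R) : \bar R :=
  ereal_sup (range (fun v : T -> R => (\sum_rs p rs * v rs)%R%:E - S v)).

Definition scaled_conjugate (S : (T -> R) -> \bar R) (q : R) (f : T -> R) :
    \bar R :=
  q%:E * convex_conjugate S (fun rs => f rs / q)%R.

Definition fluid_value (S : (T -> R) -> \bar R) (q : R) (cbar C f : T -> R) :
    \bar R :=
  ereal_inf (range (fun sigma : T -> R =>
    q%:E * S (fun rs => cbar rs - sigma rs - C rs)%R
    + (\sum_rs f rs * sigma rs)%R%:E)).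

End FluidApproximation.

(* Main.v *)
Require Import Defs.
From HB Require Import structures.
From mathcomp Require Import all_boot all_order all_algebra.
From mathcomp Require Import all_classical all_reals all_analysis.
Import Order.TTheory GRing.Theory Num.Theory.
Import numFieldNormedType.Exports.
Local Open Scope classical_set_scope.
Local Open Scope ring_scope.

(** The identity is the change of variables [v = cbar - sigma - C] in the
    Lagrangian dual.  It is a bijection of R^T onto itself, and it turns
    [f . sigma] into [f . (cbar - C) - f . v], so the dual objective becomes
    [f . (cbar - C) - q * ((f / q) . v - S v)].  Minimising over [sigma] is
    therefore maximising [(f / q) . v - S v] over [v], which is the convex
    conjugate of [S] at [f / q].

    The computation stays valid where the expected maximum utility or its
    conjugate is infinite: every sum that occurs has a finite summand, so no
    form [+oo - oo] arises.  [fluid_value_conjugate] is therefore stated for an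
    extended-real function on R^T and a scale [q > 0]; here [q] is the size of
    the nonempty group of drivers. *)

Lemma lee_subl_swap (R : realType) (K : R) (x y : \bar R) :
  (x <= K%:E - y)%E = (y <= K%:E - x)%E.
Proof.
case: x y => [x||] [y||]; rewrite ?leNye ?leey//.
by rewrite -!EFinB !lee_fin lerBrDr lerBrDl.
Qed.

(** A decreasing affine map is an order-reversing bijection of the extended
    reals; its inverse gives the upper bound on the infimum, and positivity of
    [q] makes this the same as scaling a supremum. *)
Lemma ereal_inf_affine (R : realType) (K q : R) (X : set (\bar R)) :
  0 < q ->
  ereal_inf [set K%:E - q%:E * x | x in X]%E
  = (K%:E - q%:E * ereal_sup X)%E.
Proof.
move=> q0; apply/eqP; rewrite eq_le; apply/andP; split.
- rewrite lee_subl_swap -ereal_sup_pZl//.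
  apply: ge_ereal_sup => _ [x Xx <-].
  by rewrite lee_subl_swap; apply: ereal_inf_lbound; exists x.
- apply: le_ereal_inf_tmp => _ [x Xx <-].
  by rewrite leeB// lee_pmul2l//; exact: ereal_sup_ubound.
Qed.

(** The price of a task is [cbar - C] less its utility [v], which splits off
    the constant [f . (cbar - C)]; dividing [f] by [q] then allows [q] to be
    factored out of the terms that depend on [v]. *)
Lemma dual_objective_utility (R : realType) (T : finType) (q : R)
    (cbar C f v : T -> R) (s : \bar R) :
  0 < q ->
  (q%:E * s + (\sum_rs f rs * (cbar rs - v rs - C rs))%R%:E
   = (\sum_rs f rs * (cbar rs - C rs))%R%:E
     - q%:E * ((\sum_rs f rs / q * v rs)%R%:E - s))%E.
Proof.
move=> q0.
have -> : \sum_rs f rs * (cbar rs - v rs - C rs) =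
    \sum_rs f rs * (cbar rs - C rs) - q * \sum_rs f rs / q * v rs.
  rewrite mulr_sumr -sumrB; apply: eq_bigr => rs _.
  by rewrite !mulrA (mulrC q) mulfK ?gt_eqF// addrAC mulrBr.
rewrite muleBr ?fin_num_adde_defr//.
by rewrite -EFinM oppeB ?fin_num_adde_defr// addeA addeC -EFinN -EFinD.
Qed.

(** Changing variables from prices to utilities exhibits the values of the dual
    objective as the image, under a decreasing affine map, of the values whose
    supremum is the conjugate. *)
Lemma fluid_value_conjugate (R : realType) (T : finType)
    (S : (T -> R) -> \bar R) (q : R) (cbar C f : T -> R) :
  0 < q ->
  fluid_value S q cbar C f =
    ((\sum_rs f rs * (cbar rs - C rs))%:E - scaled_conjugate S q f)%E.
Proof.
move=> q0; rewrite /scaled_conjugate /convex_conjugate -ereal_inf_affine//.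
rewrite image_comp /fluid_value.
(* [sigma |-> cbar - sigma - C] is an involution, so it serves in both
   inclusions. *)
pose u (sigma : T -> R) rs := cbar rs - sigma rs - C rs.
have uK : involutive u.
  by move=> v; apply/funext => rs; rewrite /u !opprD !opprK !addrA subrr add0r
    addrK.
congr ereal_inf; apply/seteqP; split => _ [v _ <-]; exists (u v) => //=.
- rewrite -dual_objective_utility// -/(u v).
  by congr (_ + (_)%:E)%E; apply: eq_bigr => rs _; rewrite -[in RHS](uK v).
- rewrite -dual_objective_utility//.
  by rewrite -[X in (_ * S X)%E]/(u (u v)) uK.
Qed.

Theorem lemma2 (R : realType) (A T : finType)
  (hA : (0 < #|A|)%N) (hT : (0 < #|T|)%N)
  (d : measure_display) (Omega : measurableType d) (P : probability Omega R)
  (cbar C : T -> R) (c : A -> T -> Omega -> R) (eps : A -> T -> {RV P >-> R})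
  (haru : additive_random_utility C c eps)
  (f : T -> R) (hf0 : forall rs, 0 <= f rs)
  (hfq : \sum_(rs : T) f rs = #|A|%:R) (a : A) :
  let q : R := #|A|%:R in
  let S := expected_max_utility (eps a) in
  fluid_value S q cbar C f =
    ((\sum_(rs : T) f rs * (cbar rs - C rs))%:E - scaled_conjugate S q f)%E.
Proof.
by move=> q S; apply: fluid_value_conjugate; rewrite ltr0n.
Qed.
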